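(* Let $q$ be a prime power and let $p(x)\in \mathbb{F}_q[x]$ be a monic irreducible polynomial of degree $k\geq 1$ with $p(1)\neq 0$. Let $m=q^k-1$ and define the rational function $g(x)=\dfrac{x^m-1}{(x-1)\,p(x)}$. Then $p(x)$ is primitive if and only if $g(x)$ is a polynomial with exactly $(q-1)q^{k-1}-1$ nonzero coefficients.
   Context: $\mathbb{F}_q$ denotes the finite field with $q$ elements. A polynomial $p(x)\in\mathbb{F}_q[x]$ of degree $k$ is called primitive if it is irreducible over $\mathbb{F}_q$, $p(0)\neq 0$, and a root of $p(x)$ in $\mathbb{F}_{q^k}$ has multiplicative order $q^k-1$, i.e. generates the cyclic group $\mathbb{F}_{q^k}^*$. The number of nonzero terms of a polynomial means the number of its nonzero coefficients. *)

(* Defs.v *)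
From HB Require Import structures.
From mathcomp Require Import all_boot all_order all_algebra all_field.

Set Implicit Arguments.
Unset Strict Implicit.
Unset Printing Implicit Defensive.

Import GRing.Theory.
Local Open Scope ring_scope.

(* The degree-k extension L of F is the field with #|F| ^ k elements. Such an L
   is unique up to isomorphism, and the roots in L of an irreducible p are
   conjugate over F, so the property does not depend on the chosen L and a.
   (qfpoly.primitive_poly is instead phrased by divisibility of 'X^n - 1 by p,
   and also requires p to be monic.) *)
Definition root_primitive_poly (F : finFieldType) (p : {poly F}) : Prop :=
  let k := (size p).-1 in
  [/\ irreducible_poly p,
      p.[0] != 0
    & exists (L : fieldExtType F) (a : L),
        [/\ \dim {:L} = k,
            root (map_poly (in_alg L) p) a
          & (#|F| ^ k - 1)%N.-primitive_root a]].

Definition nb_nonzero_coefs (F : fieldType) (p : {poly F}) : nat :=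
  count (fun c => c != 0) p.

(* Main.v *)
(** Put [m = q^k - 1] and let [h] be the quotient, so that
    [p h = 1 + X + ... + X^(m-1)]. Comparing coefficients, the sequence
    [n |-> h_(m-1-n) - 1/p(1)] satisfies the linear recurrence with
    characteristic polynomial [p], hence is [n |-> f (a^n)] for a root [a] of
    [p] and a nonzero [F]-linear form [f] on [F(a)]. When [p] is primitive the
    powers of [a] run over all nonzero elements, and [h] vanishes exactly where
    [f] takes the nonzero value [-1/p(1)], that is [q^(k-1)] times. When [a] has
    order [m/d], [h] consists of [d] shifted copies of the quotient of
    [1 + X + ... + X^(m/d-1)] by [p], so [d] divides both [m] and the weight
    [m - q^(k-1)] of [h]; as [m] is coprime to [q], this forces [d = 1]. *)
Require Import Defs.
From HB Require Import structures.
From mathcomp Require Import all_boot all_order all_algebra all_field.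

Set Implicit Arguments.
Unset Strict Implicit.
Unset Printing Implicit Defensive.

Import GRing.Theory.
Local Open Scope ring_scope.

Section NonzeroCoefficients.

Variable F : fieldType.
Implicit Types p u v : {poly F}.

Lemma nb_nonzero_coefsE p n :
  (size p <= n)%N -> nb_nonzero_coefs p = #|[set i : 'I_n | p`_i != 0]|.
Proof.
move=> le_pn; rewrite /nb_nonzero_coefs -sum1_count (big_nth 0) big_mkord.
rewrite (big_ord_widen_cond n (fun i => p`_i != 0) (fun=> 1%N)) //.
rewrite sum1dep_card; apply: eq_card => i; rewrite !inE.
by case: ltnP => [|le_pi]; rewrite ?andbT // nth_default ?eqxx.
Qed.

Lemma nb_nonzero_coefs_zeros p n :
  (size p <= n)%N ->
  (nb_nonzero_coefs p + #|[set i : 'I_n | (p`_i == 0)%R]| = n)%N.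
Proof.
move=> le_pn; rewrite (nb_nonzero_coefsE le_pn) addnC -[RHS]card_ord.
rewrite -(cardsC [set i : 'I_n | p`_i == 0]); congr (_ + _)%N.
by apply: eq_card => i; rewrite !inE.
Qed.

Lemma nb_nonzero_coefs_addMXn u v n :
  (size u <= n)%N ->
  nb_nonzero_coefs (u + v * 'X^n) = (nb_nonzero_coefs u + nb_nonzero_coefs v)%N.
Proof.
move=> le_un; have le_sum : (size (u + v * 'X^n)%R <= n + size v)%N.
  rewrite (leq_trans (size_polyD _ _)) // geq_max.
  rewrite (leq_trans le_un) ?leq_addr //.
  by rewrite (leq_trans (size_polyMleq _ _)) // size_polyXn addnS addnC.
rewrite (nb_nonzero_coefsE le_sum) (nb_nonzero_coefsE le_un).
rewrite (nb_nonzero_coefsE (leqnn _)) -!sum1dep_card big_mkcond.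
rewrite big_split_ord -!big_mkcond; congr (_ + _)%N; apply: eq_bigl => i /=.
  by rewrite coefD coefMXn ltn_ord addr0.
rewrite coefD coefMXn ltnNge leq_addr /= addKn [u`_ _]nth_default ?add0r //.
by rewrite (leq_trans le_un) ?leq_addr.
Qed.

Lemma nb_nonzero_coefs_mul_sumXn u n d :
  (size u <= n)%N ->
  nb_nonzero_coefs (u * \sum_(i < d) 'X^n ^+ i) = (d * nb_nonzero_coefs u)%N.
Proof.
move=> le_un; elim: d => [|d IHd].
  by rewrite big_ord0 mulr0 /nb_nonzero_coefs polyseq0.
rewrite big_ord_recl expr0 mulrDr mulr1.
under eq_bigr do rewrite exprSr.
by rewrite -mulr_suml mulrA nb_nonzero_coefs_addMXn // IHd mulSn.
Qed.

End NonzeroCoefficients.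

Definition geometric_poly {R : nzSemiRingType} (n : nat) : {poly R} :=
  \poly_(i < n) 1.

Section GeometricPolynomial.

Variable R : idomainType.
Implicit Types p h : {poly R}.

Lemma size_geometric_poly n : size (geometric_poly n : {poly R}) = n.
Proof. by rewrite size_poly_eq ?oner_neq0. Qed.

Lemma horner_geometric_poly0 n :
  (0 < n)%N -> (geometric_poly n).[0] = 1 :> R.
Proof. by move=> n_gt0; rewrite horner_coef0 coef_poly n_gt0. Qed.

Lemma Xsub1_neq0 : 'X - 1 != 0 :> {poly R}.
Proof. by rewrite -polyC1 polyXsubC_eq0. Qed.

Lemma mul_Xsub1_geometric_poly n :
  ('X - 1) * geometric_poly n = 'X^n - 1 :> {poly R}.
Proof.
rewrite subrX1 /geometric_poly poly_def; congr (_ * _).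
by apply: eq_bigr => i _; rewrite scale1r.
Qed.

Lemma geometric_polyM d n :
  geometric_poly (d * n) =
    geometric_poly n * \sum_(i < d) 'X^n ^+ i :> {poly R}.
Proof.
apply: (mulfI Xsub1_neq0); rewrite mulrA !mul_Xsub1_geometric_poly.
by rewrite mulnC exprM subrX1.
Qed.

Lemma Xn_sub1_fraction_eq p h n : p != 0 ->
  tofrac ('X^n - 1) / tofrac (('X - 1) * p) = tofrac h <->
  p * h = geometric_poly n.
Proof.
move=> p_neq0; have den_neq0 : tofrac (('X - 1) * p) != 0.
  by rewrite tofrac_eq0 mulf_neq0 ?Xsub1_neq0.
rewrite -mul_Xsub1_geometric_poly.
split=> [/(canRL (divfK den_neq0)) /eqP | <-].
  rewrite -tofracM tofrac_eq mulrCA => /eqP /(mulfI Xsub1_neq0) ->.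
  exact: mulrC.
by rewrite mulrA tofracM mulrC mulKf.
Qed.

Lemma geometric_factor_neq0 p h n :
  (0 < n)%N -> p * h = geometric_poly n -> p != 0.
Proof.
move=> n_gt0 def_ph; apply: contraTneq n_gt0 => p0.
by rewrite -[n]size_geometric_poly -def_ph p0 mul0r size_poly0.
Qed.

Lemma size_geometric_cofactor p h n :
  (0 < n)%N -> p * h = geometric_poly n -> (size p + size h = n.+1)%N.
Proof.
move=> n_gt0 def_ph; have p_neq0 := geometric_factor_neq0 n_gt0 def_ph.
have h_neq0 : h != 0.
  by rewrite mulrC in def_ph; apply: geometric_factor_neq0 def_ph.
rewrite -[n in RHS]size_geometric_poly -def_ph size_mul // prednK //.
by rewrite addn_gt0 size_poly_gt0 p_neq0.
Qed.

End GeometricPolynomial.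

Lemma dvdp_geometric_poly {F : fieldType} (p : {poly F}) n :
  p.[1] != 0 -> (p %| geometric_poly n) = (p %| 'X^n - 1).
Proof.
move=> p1_neq0; rewrite -mul_Xsub1_geometric_poly Gauss_dvdpr //.
by rewrite -polyC1 coprimep_XsubC.
Qed.

Lemma nb_nonzero_coefs_geometric_cofactor {F : fieldType}
    (p h u : {poly F}) d n :
  (0 < n)%N -> p * u = geometric_poly n -> p * h = geometric_poly (d * n) ->
  nb_nonzero_coefs h = (d * nb_nonzero_coefs u)%N.
Proof.
move=> n_gt0 def_pu def_ph; have p_neq0 := geometric_factor_neq0 n_gt0 def_pu.
have -> : h = u * \sum_(i < d) 'X^n ^+ i.
  by apply: (mulfI p_neq0); rewrite def_ph geometric_polyM -def_pu mulrA.
apply: nb_nonzero_coefs_mul_sumXn.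
rewrite -ltnS -(size_geometric_cofactor n_gt0 def_pu) -[X in (X < _)%N]add0n.
by rewrite ltn_add2r size_poly_gt0.
Qed.

Definition linear_recurrence {R : nzRingType} (p : {poly R}) (m : nat)
    (s : nat -> R) : Prop :=
  forall n, (n + size p <= m)%N -> \sum_(i < size p) p`_i * s (n + i)%N = 0.

Lemma linear_recurrence_uniq {R : idomainType} (p : {poly R}) m
    (s t : nat -> R) :
  p != 0 -> linear_recurrence p m s -> linear_recurrence p m t ->
  (forall n, (n < (size p).-1)%N -> s n = t n) ->
  forall n, (n < m)%N -> s n = t n.
Proof.
move=> p_neq0 s_rec t_rec eq_init; set k := (size p).-1 in eq_init.
have lead_neq0 : p`_k != 0 by rewrite -lead_coefE lead_coef_eq0.
have size_p : size p = k.+1 by rewrite prednK ?size_poly_gt0.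
elim/ltn_ind => n IHn lt_nm; case: (ltnP n k) => [/eq_init //|le_kn].
have le_m : (n - k + size p <= m)%N by rewrite size_p addnS subnK.
have := etrans (s_rec _ le_m) (esym (t_rec _ le_m)).
rewrite size_p !big_ord_recr /= subnK //.
rewrite (eq_bigr (fun i : 'I_k => p`_i * t (n - k + i)%N)).
  by move/addrI/(mulfI lead_neq0).
move=> i _; have lt_n : (n - k + i < n)%N.
  by rewrite -[X in (_ < X)%N](subnK le_kn) ltn_add2l.
by rewrite IHn // (ltn_trans lt_n).
Qed.

Lemma coefM_size {R : nzSemiRingType} (p h : {poly R}) n :
  (size p <= n.+1)%N -> (p * h)`_n = \sum_(i < size p) p`_i * h`_(n - i).
Proof.
move=> le_pn; rewrite coefM.
rewrite (big_ord_widen _ (fun i => p`_i * h`_(n - i)) le_pn).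
rewrite [RHS]big_mkcond; apply: eq_bigr => i _.
by case: ltnP => // le_pi; rewrite nth_default ?mul0r.
Qed.

Lemma geometric_cofactor_recurrence {F : fieldType} (p h : {poly F}) m :
  p.[1] != 0 -> p * h = geometric_poly m ->
  linear_recurrence p m (fun n => h`_(m - n.+1) - p.[1]^-1).
Proof.
move=> p1_neq0 def_ph n le_nm.
have p_gt0 : (0 < size p)%N.
  by rewrite size_poly_gt0; apply: contraNneq p1_neq0 => ->; rewrite horner0.
have lt_nm : (n < m)%N by rewrite (leq_trans _ le_nm) // -addn1 leq_add2l.
have sum_ph : \sum_(i < size p) p`_i * h`_(m - (n + i).+1) = 1.
  under eq_bigr do rewrite -addSn subnDA.
  rewrite -coefM_size ?def_ph ?coef_poly; last first.
    by rewrite subnSK // leq_subRL // ltnW.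
  by rewrite ltn_subrL (leq_ltn_trans _ lt_nm).
have sum_p : \sum_(i < size p) p`_i = p.[1].
  by rewrite horner_coef; apply: eq_bigr => i _; rewrite expr1n mulr1.
under eq_bigr do rewrite mulrBr.
by rewrite sumrB sum_ph -mulr_suml sum_p divff ?subrr.
Qed.

Section PolynomialRoot.

Variables (F : fieldType) (L : fieldExtType F) (p : {poly F}) (a : L).
Hypothesis root_a : root (map_poly (in_alg L) p) a.

Lemma linear_form_recurrence (f : 'Hom(L, F^o)) m :
  linear_recurrence p m (fun n => f (a ^+ n)).
Proof.
move=> n _; transitivity (f (a ^+ n * (map_poly (in_alg L) p).[a])); last first.
  by rewrite (rootP root_a) mulr0 linear0.
rewrite horner_coef size_map_poly mulr_sumr linear_sum; apply: eq_bigr => i _.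
by rewrite coef_map /= mulr_algl -scalerAr -exprD linearZ.
Qed.

Hypothesis p_irr : irreducible_poly p.

Lemma irreducible_dvdp_root r : (p %| r) = root (map_poly (in_alg L) r) a.
Proof.
apply/idP/idP => [/dvdpP[s ->] | root_r].
  by rewrite rmorphM rootM root_a orbT.
apply: contraTT root_r; rewrite -irreducible_poly_coprime // => co_pr.
rewrite -(coprimep_map (in_alg L)) in co_pr.
exact: coprimep_root co_pr root_a.
Qed.

Lemma irreducible_dvdp_geometric_poly n :
  p.[1] != 0 -> (p %| geometric_poly n) = (a ^+ n == 1).
Proof.
move=> p1_neq0; rewrite dvdp_geometric_poly // irreducible_dvdp_root.
by rewrite rmorphB rmorph1 /= map_polyXn rootE !hornerE subr_eq0.
Qed.

Lemma irreducible_root_free : free [tuple a ^+ i | i < (size p).-1].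
Proof.
apply/freeP=> c sum_c0; pose r := \sum_(i < (size p).-1) c i *: 'X^i.
have coef_r (i : 'I_(size p).-1) : r`_i = c i.
  rewrite coef_sum (bigD1 i) //= coefZ coefXn eqxx mulr1 big1 ?addr0 // => j.
  by rewrite coefZ coefXn eq_sym -val_eqE => /negbTE ->; rewrite mulr0.
have size_r : (size r < size p)%N.
  rewrite -(ltn_predK p_irr.1) ltnS.
  apply: (leq_trans (size_sum _ _ _)); apply/bigmax_leqP => i _.
  by rewrite (leq_trans (size_scale_leq _ _)) // size_polyXn.
suff r0 : r = 0 by move=> i; rewrite -coef_r r0 coef0.
apply/eqP; apply: contraTT size_r => r_neq0; rewrite -leqNgt.
apply: dvdp_leq r_neq0 _; rewrite irreducible_dvdp_root rootE.
rewrite -sum_c0 /r rmorph_sum horner_sum; apply/eqP/eq_bigr => i _.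
rewrite -tnth_nth tnth_mktuple /= map_polyZ map_polyXn !hornerE.
by rewrite mulr_algl.
Qed.

Lemma linear_form_on_powers (s : nat -> F) :
  exists f : 'Hom(L, F^o), forall n, (n < (size p).-1)%N -> f (a ^+ n) = s n.
Proof.
set k := (size p).-1.
have [f] := @linear_of_free F L F^o [tuple a ^+ i | i < k] [tuple s i | i < k].
rewrite !size_tuple irreducible_root_free => /(_ isT erefl) /= /esym.
rewrite -map_comp => /eq_in_map f_powers; exists (linfun f) => n lt_nk.
by rewrite lfunE /= [RHS](f_powers (Ordinal lt_nk)) ?mem_enum.
Qed.

Lemma linear_recurrence_form m (s : nat -> F) :
  linear_recurrence p m s ->
  exists f : 'Hom(L, F^o), forall n, (n < m)%N -> f (a ^+ n) = s n.
Proof.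
move=> s_rec; have [f f_init] := linear_form_on_powers s; exists f.
have p_neq0 : p != 0 by rewrite -size_poly_gt0 ltnW ?p_irr.1.
apply: (linear_recurrence_uniq p_neq0 _ s_rec f_init).
exact: linear_form_recurrence.
Qed.

End PolynomialRoot.

Section LinearFormFibers.

Variables (F : finFieldType) (V : vectType F).

Lemma card_finvect_type : #|finvect_type V| = (#|F| ^ \dim {:V})%N.
Proof.
have := card_vspace {: finvect_type V}; rewrite card_vspacef => ->.
by rewrite !dimvf.
Qed.

Lemma card_linear_form_fiber (f : 'Hom(V, F^o)) (b : F) :
  f != 0 ->
  (#|F| * #|[set v : finvect_type V | f v == b]| = #|F| ^ \dim {:V})%N.
Proof.
case/lfunPn=> v; rewrite zero_lfunE => fv_neq0.
pose g : finvect_type V -> F := f.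
have fiber_card c : #|[set w | g w == c]| = #|[set w | g w == b]|.
  pose t : finvect_type V := ((c - b) / f v) *: v.
  have g_addt w : g (t + w) = c - b + g w.
    by rewrite /g linearD linearZ /= [_ *: _]divfK.
  rewrite -(card_imset [set w | g w == b] (addrI t)).
  apply: eq_card => w; rewrite inE; apply/eqP/imsetP => [gw | [u]].
    exists (w - t); last by rewrite addrC subrK.
    by rewrite inE; apply/eqP/(addrI (c - b)); rewrite -g_addt addrC !subrK.
  by rewrite inE => /eqP gu ->; rewrite g_addt gu subrK.
rewrite -card_finvect_type -[RHS]sum1_card (partition_big g predT) //=.
under [RHS]eq_bigr => c _ do rewrite sum1dep_card fiber_card.
by rewrite sum_nat_const.
Qed.

End LinearFormFibers.

Section PrimitiveRoot.

Variables (F : finFieldType) (L : fieldExtType F) (a : L).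
Local Notation m := (#|F| ^ \dim {:L}).-1.

Lemma expf_finvect_predn (x : L) : x != 0 -> x ^+ m = 1.
Proof.
move=> x_neq0; have := expf_card (x : finvect_type L).
rewrite card_finvect_type -(prednK (_ : 0 < #|F| ^ \dim {:L})%N); last first.
  by rewrite expn_gt0 (ltnW (finNzRing_gt1 F)).
by rewrite exprS -[RHS]mulr1 => /(mulfI x_neq0).
Qed.

Hypothesis a_prim : m.-primitive_root a.

Lemma card_primitive_powers_fiber (f : 'Hom(L, F^o)) (b : F) :
  f != 0 -> b != 0 ->
  (#|F| * #|[set i : 'I_m | f (a ^+ i) == b]| = #|F| ^ \dim {:L})%N.
Proof.
move=> f_neq0 b_neq0; rewrite -[RHS](card_linear_form_fiber b f_neq0).
pose exp_a (i : 'I_m) : finvect_type L := a ^+ i.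
have exp_a_inj : injective exp_a.
  move=> i j /eqP; rewrite (eq_prim_root_expr a_prim) !modn_small //.
  by move/eqP/val_inj.
rewrite -(card_imset _ exp_a_inj); congr (_ * _)%N; apply: eq_card => x.
rewrite [RHS]inE; apply/imsetP/idP => [[i] | fx]; first by rewrite inE => ? ->.
have x_neq0 : x != 0 by apply: contraTneq fx => ->; rewrite linear0 eq_sym.
have [i def_x] := prim_rootP a_prim (expf_finvect_predn x_neq0).
by exists i; rewrite ?inE -?def_x.
Qed.

Variables p h : {poly F}.
Hypotheses (p_irr : irreducible_poly p) (p1_neq0 : p.[1] != 0).
Hypothesis root_a : root (map_poly (in_alg L) p) a.
Hypothesis def_ph : p * h = geometric_poly m.

Let m_gt0 : (0 < m)%N := prim_order_gt0 a_prim.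

Let size_h : (size h <= m.-1)%N.
Proof.
rewrite -ltnS prednK // -ltnS -(size_geometric_cofactor m_gt0 def_ph).
by rewrite -add2n leq_add2r p_irr.1.
Qed.

Lemma card_zeros_geometric_cofactor :
  (#|F| * #|[set i : 'I_m | (h`_i == 0)%R]| = #|F| ^ \dim {:L})%N.
Proof.
have h_rec := geometric_cofactor_recurrence p1_neq0 def_ph.
have [f f_powers] := linear_recurrence_form root_a p_irr h_rec.
have b_neq0 : - p.[1]^-1 != 0 by rewrite oppr_eq0 invr_eq0.
have f_neq0 : f != 0.
  apply/lfunPn; exists (a ^+ 0); rewrite f_powers // zero_lfunE subn1.
  by rewrite nth_default ?size_h // sub0r.
rewrite -[RHS](card_primitive_powers_fiber f_neq0 b_neq0).
rewrite -(card_imset _ rev_ord_inj); congr (_ * _)%N; apply: eq_card => i.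
rewrite inE f_powers // -subr_eq0 opprK subrK -[(m - i.+1)%N]/(val (rev_ord i)).
apply/imsetP/idP => [[j] | hi]; first by rewrite inE => hj ->; rewrite rev_ordK.
by exists (rev_ord i); rewrite ?rev_ordK ?inE.
Qed.

Lemma nb_nonzero_coefs_primitive :
  (nb_nonzero_coefs h + #|F| ^ (\dim {:L}).-1)%N = m.
Proof.
rewrite -[RHS](nb_nonzero_coefs_zeros (leq_trans size_h (leq_pred m))).
congr (_ + _)%N; apply/eqP.
rewrite -(eqn_pmul2l (ltnW (finNzRing_gt1 F))) card_zeros_geometric_cofactor.
by rewrite -expnS prednK ?adim_gt0.
Qed.

End PrimitiveRoot.

Lemma dvdn_expn_predn_eq1 q k d :
  (0 < q)%N -> (d %| q ^ k.-1)%N -> (d %| (q ^ k).-1)%N -> d = 1%N.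
Proof.
move=> q_gt0 d_dvd_pow d_dvd_pred; apply/eqP; rewrite -dvdn1.
rewrite -(eqP (coprimePn (_ : 0 < q ^ k)%N)) ?expn_gt0 ?q_gt0 //.
by rewrite dvdn_gcd d_dvd_pred (dvdn_trans d_dvd_pow) ?dvdn_exp2l ?leq_pred.
Qed.

Lemma primitive_root_nb_nonzero_coefs {F : finFieldType} {L : fieldExtType F}
    (p h : {poly F}) (a : L) k :
  (0 < k)%N -> irreducible_poly p -> p.[1] != 0 ->
  root (map_poly (in_alg L) p) a -> p * h = geometric_poly (#|F| ^ k).-1 ->
  (nb_nonzero_coefs h + #|F| ^ k.-1)%N = (#|F| ^ k).-1 ->
  (#|F| ^ k).-1.-primitive_root a.
Proof.
move=> k_gt0 p_irr p1_neq0 root_a; set m := (#|F| ^ k).-1 => def_ph wt_h.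
have F_gt1 : (1 < #|F|)%N := finNzRing_gt1 F.
have dvd_geometric n := irreducible_dvdp_geometric_poly root_a p_irr n p1_neq0.
have m_gt0 : (0 < m)%N by rewrite ltn_predRL -(exp1n k) ltn_exp2r.
have a_expm : a ^+ m = 1 by apply/eqP; rewrite -dvd_geometric -def_ph dvdp_mulr.
have [n a_prim /dvdnP[d def_m]] := prim_order_exists m_gt0 a_expm.
have n_gt0 := prim_order_gt0 a_prim.
have /dvdpP[u def_u] : p %| geometric_poly n.
  by rewrite dvd_geometric prim_expr_order.
have wt_hu : nb_nonzero_coefs h = (d * nb_nonzero_coefs u)%N.
  apply: (@nb_nonzero_coefs_geometric_cofactor _ p _ _ _ n) => //.
    by rewrite mulrC.
  by rewrite -def_m.
suff d_eq1 : d = 1%N by rewrite def_m d_eq1 mul1n.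
have d_dvd_m : (d %| m)%N by rewrite def_m dvdn_mulr.
apply: (dvdn_expn_predn_eq1 (ltnW F_gt1) _ d_dvd_m).
by move: d_dvd_m; rewrite -wt_h wt_hu dvdn_addr ?dvdn_mulr.
Qed.

Lemma primitive_weight_addn q k : (1 < q)%N -> (0 < k)%N ->
  ((q - 1) * q ^ (k - 1) - 1 + q ^ k.-1 = (q ^ k).-1)%N.
Proof.
move=> q_gt1 k_gt0.
have lt_pow : (q ^ k.-1 < q ^ k)%N by rewrite ltn_exp2l // ltn_predL.
rewrite mulnBl mul1n -expnS (subn1 k) prednK // addnBAC ?subn_gt0 //.
by rewrite subnK ?subn1 // ltnW.
Qed.

Theorem theorem1 (q k : nat) (F : finFieldType) (p : {poly F})
    (hq : #|F| = q) (hk : (1 <= k)%N) (hdeg : size p = k.+1)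
    (hmonic : p \is monic) (hirr : irreducible_poly p) (hp1 : p.[1] != 0) :
  let m := (q ^ k - 1)%N in
  let g : {fraction {poly F}} :=
    tofrac ('X^m - 1 : {poly F}) / tofrac (('X - 1) * p) in
  root_primitive_poly p <->
  exists h : {poly F},
    g = tofrac h /\ nb_nonzero_coefs h = ((q - 1) * q ^ (k - 1) - 1)%N.
Proof.
move=> m g; rewrite {}/g {}/m -{q}hq subn1.
have p_neq0 : p != 0 := monic_neq0 hmonic.
have F_gt1 : (1 < #|F|)%N := finNzRing_gt1 F.
have weightE := primitive_weight_addn F_gt1 hk.
split=> [[_ _ [L [a]]] | [h [/(Xn_sub1_fraction_eq _ _ p_neq0) def_ph wt_h]]].
  rewrite hdeg subn1 /= => -[dimL root_a a_prim].
  have /dvdpP[h def_h] : p %| geometric_poly (#|F| ^ k).-1.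
    by rewrite (irreducible_dvdp_geometric_poly root_a hirr) ?prim_expr_order.
  have def_ph : p * h = geometric_poly (#|F| ^ k).-1 by rewrite mulrC.
  exists h; split; first exact/Xn_sub1_fraction_eq.
  apply: (@addIn (#|F| ^ k.-1)%N); rewrite weightE.
  rewrite -[k]dimL in a_prim def_ph *.
  exact: (nb_nonzero_coefs_primitive a_prim hirr hp1 root_a def_ph).
have [L dimL [a root_a _]] := irredp_FAdjoin hirr.
have a_prim : (#|F| ^ k).-1.-primitive_root a.
  by apply: primitive_root_nb_nonzero_coefs root_a def_ph _; rewrite // wt_h.
split=> //; last by exists L, a; rewrite dimL hdeg subn1.
apply: contra_neq (oner_neq0 F) => p0.
rewrite -(horner_geometric_poly0 F (prim_order_gt0 a_prim)) -def_ph hornerM p0.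
by rewrite mul0r.
Qed.
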